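(* Suppose $G$ satisfies the anchored isoperimetric inequality at root $o$ with function $\mathcal F$ and constant $C_{IS}>0$. Then for any subset $A\subset G$ with $0<m(A)<\infty$: $$\mathbb{E}_o(\tau_A)\le 2\int_0^\infty v^A_+(s)\,ds,$$ and, when the walk $X$ is transient and the solution $v$ below exists, $$\mathbb{E}_o(l_A)\le 2\int_0^\infty v_{+A}(s)\,ds .$$ Here $v^A$ is the solution of $v^A(0)=m(A)$, $(v^A)'=-(C_{IS}\,\mathcal F(v^A))^2$, and $v$ is the solution of $v(0)=+\infty$ (i.e. $v(s)\to+\infty$ as $s\to0^+$), $v'=-(C_{IS}\,\mathcal F(v))^2$. The truncations are: $v^A_+(s)=v^A(s)$ if $v^A(s)>0$ and $v^A_+(s)=0$ otherwise; $v_{+A}(s)=0$ if $v(s)\le 0$, $v_{+A}(s)=m(A)$ if $v(s)\ge m(A)$, and $v_{+A}(s)=v(s)$ otherwise. (Right-hand sides may be $+\infty$.)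
   Context: $G$ is a countable vertex set with a distinguished vertex $o$ (the root); it is not assumed locally finite. $(X_n)_{n\ge0}$ is a Markov chain (random walk) on $G$ with transition probabilities $p(\cdot,\cdot)$ having a reversible measure $m$ with $0<m(x)<\infty$ for all $x$: $\mu(x,y):=m(x)p(x,y)=\mu(y,x)$. For $A\subset G$: $m(A)=\sum_{x\in A}m(x)$ and $\mu(\partial A)=\sum_{x\in A,\,y\notin A}\mu(x,y)$. A set $A$ is connected if any two points of $A$ can be joined by a finite path $x_0,x_1,\dots,x_n$ in $A$ with $p(x_i,x_{i+1})>0$ for all $i$. $G$ satisfies the anchored isoperimetric inequality at $o$ with function $\mathcal F$ and constant $C_{IS}>0$ if $\mu(\partial A)\ge C_{IS}\,\mathcal F(m(A))$ for every connected $A\subset G$ with $o\in A$ and $m(A)<\infty$. Here $\mathcal F:\mathbb{R}_+\to\mathbb{R}_+$ is nondecreasing and positive on $(0,\infty)$. $\mathbb{P}_x,\mathbb{E}_x$ denote law and expectation for the walk started at $x$. $\tau_A=\inf\{k\ge0: X_k\notin A\}$ is the exit time and $l_A=\#\{k\in\mathbb{N}:X_k\in A\}$ (with $\mathbb{N}\ni 0$) is the occupation time. Solutions of the differential equations are understood as decreasing locally absolutely continuous functions satisfying the equation almost everywhere as long as they are positive; once a solution reaches $0$ its truncation is $0$ from then on. The solution $v$ exists exactly when $\int_1^\infty \mathcal F(x)^{-2}dx<\infty$. *)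

(* Defs.v *)
From mathcomp Require Import all_boot all_order all_algebra.
From mathcomp Require Import all_classical all_reals all_analysis.

Set Implicit Arguments.
Unset Strict Implicit.
Unset Printing Implicit Defensive.

Import Order.TTheory GRing.Theory Num.Theory.
Import numFieldNormedType.Exports.

Local Open Scope classical_set_scope.
Local Open Scope ring_scope.

Section ReversibleChain.
Context {R : realType} {G : countType}.
Implicit Types (p : G -> G -> R) (m : G -> R) (A : set G).

Definition stochastic p : Prop :=
  (forall x y, 0 <= p x y) /\
  (forall x, \esum_(y in [set: G]) (p x y)%:E = 1%E).

Definition reversible p m : Prop :=
  (forall x, 0 < m x) /\ (forall x y, m x * p x y = m y * p y x).

Definition vol m A : \bar R := \esum_(x in A) (m x)%:E.

Definition bdry p m A : \bar R :=
  \esum_(x in A) \esum_(y in ~` A) (m x * p x y)%:E.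

Definition connected_set p A : Prop :=
  forall x y, A x -> A y -> exists s : seq G,
    [/\ path (fun a b => 0 < p a b) x s, last x s = y &
        forall z, z \in s -> A z].

(* Only the restriction of F to [0, +oo[ matters. *)
Definition isoperimetric_function (F : R -> R) : Prop :=
  [/\ forall x, 0 <= x -> 0 <= F x,
      forall x y, 0 <= x -> x <= y -> F x <= F y &
      forall x, 0 < x -> 0 < F x].

Definition anchored_isoperimetric p m (o : G) (F : R -> R) (C : R) : Prop :=
  0 < C /\
  forall A, connected_set p A -> A o -> (vol m A < +oo)%E ->
    ((C * F (fine (vol m A)))%:E <= bdry p m A)%E.

End ReversibleChain.

Section Walk.
Context {R : realType} {G : countType}.
Context {d : measure_display} {Omega : measurableType d}.
Implicit Types (P : probability Omega R) (X : nat -> Omega -> G).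

(* G carries the discrete sigma-algebra.  The Markov property is written in
   product form, so that no conditioning on null events is needed. *)
Definition markov_chain_from P X (p : G -> G -> R) (x : G) : Prop :=
  [/\ forall n (B : set G), measurable (X n @^-1` B),
      P [set w | X 0%N w = x] = 1%E &
      forall n (y : nat -> G),
        P [set w | forall k, (k <= n.+1)%N -> X k w = y k] =
        (P [set w | forall k, (k <= n)%N -> X k w = y k]
           * (p (y n) (y n.+1))%:E)%E].

Definition transient (P : G -> probability Omega R) X : Prop :=
  forall x, (P x [set w | exists n, X n.+1 w = x] < 1)%E.

Definition exit_time X (A : set G) (w : Omega) : \bar R :=
  ereal_inf [set (k%:R)%:E | k in [set k : nat | ~ A (X k w)]].

Definition occupation_time X (A : set G) (w : Omega) : \bar R :=
  counting [set k : nat | A (X k w)].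

End Walk.

Section ODE.
Context {R : realType}.
Implicit Types (F v : R -> R) (C a b : R).

Definition abs_continuous_on a b v : Prop :=
  forall e, 0 < e -> exists2 delta, 0 < delta &
    forall (n : nat) (l r : 'I_n -> R),
      (forall i, [/\ a <= l i, l i <= r i & r i <= b]) ->
      (forall i j, i != j -> r i <= l j \/ r j <= l i) ->
      \sum_(i < n) (r i - l i) < delta ->
      \sum_(i < n) `|v (r i) - v (l i)| < e.

(* The equation is only imposed where v is positive; past its first zero a
   solution may be any nonincreasing absolutely continuous function, and its
   truncation vanishes there. *)
Definition satisfies_ode F C v : Prop :=
  {ae lebesgue_measure, forall s : R, 0 < s -> 0 < v s ->
    is_derive s 1 v (- (C * F (v s)) ^+ 2)}.

Definition solution_from F C (v0 : \bar R) v : Prop :=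
  [/\ (v 0)%:E = v0,
      forall s t, 0 <= s -> s <= t -> v t <= v s,
      forall b, 0 <= b -> abs_continuous_on 0 b v &
      satisfies_ode F C v].

(* v(0) = +oo is a right limit, so the conditions are on ]0, +oo[ and the
   value of the total function v at 0 is irrelevant. *)
Definition solution_from_pinfty F C v : Prop :=
  [/\ v s @[s --> 0^'+] --> +oo,
      forall s t, 0 < s -> s <= t -> v t <= v s,
      forall a b, 0 < a -> a <= b -> abs_continuous_on a b v &
      satisfies_ode F C v].

Definition trunc v (s : R) : \bar R := if 0 < v s then (v s)%:E else 0%E.

Definition trunc_at (M : \bar R) v (s : R) : \bar R :=
  if v s <= 0 then 0%E else if (M <= (v s)%:E)%E then M else (v s)%:E.

End ODE.

(* Main.v *)
Require Import Defs.
From mathcomp Require Import all_boot all_order all_algebra.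
From mathcomp Require Import all_classical all_reals all_analysis.
From mathcomp Require Import measurable_realfun ring lra.

Import Order.TTheory GRing.Theory Num.Theory.
Import numFieldNormedType.Exports.
Local Open Scope classical_set_scope.
Local Open Scope ring_scope.

(** Why the bounds hold.  Put [u(x) = E_o(number of visits to x) / m(x)] for the
    walk killed on leaving a set [S], so that the expected time spent in [A] is
    the sum of [m(x) u(x)] over [A].  Let [K_t = {u > t}].

    - The net flow [sum mu(x,y) (u(x) - u(y))] out of [K_t] is at most 1, because
      the walk started at [o] is the only source ([flow_le1]).  By a maximum
      principle every point of [K_t] is joined to [o] inside [K_t]
      ([superlevel_reached]), so the isoperimetric inequality applies to [K_t].
    - Spread the measure over the edges: the ordered edge [(x,y)] carries the mass
      [mu(x,y)] uniformly along the segment from [u(x)] to [u(y)].  Let [2 U(t)]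
      be the edge mass above level [t].  This loses nothing on average, and
      [U(t) <= m(K_t)], because an edge with a point above [t] has an endpoint
      in [K_t] ([edge_volume_le]); the factor 2 of the theorem is the price of
      this step.
    - Just to the right of [t] the slope of [U] is at most
      [- sum mu(x,y) / (u(x) - u(y))], the sum being over the edges leaving [K_t].
      By Cauchy-Schwarz and the bound on the flow this is at most
      [- mu(boundary of K_t)^2 <= - (C F(m(K_t)))^2 <= - (C F(U(t)))^2]
      ([edge_volume_slope]).  Thus [U] is a subsolution of the equation whose only
      jumps are downwards, and it stays below the solution ([ode_comparison]).
    - The edges that touch [A] carry at least the sum of [m(x) u(x)] over [A], and
      at most [2 min(U(t), m(A))] of their mass lies above [t]
      ([killed_sum_le_integral]).  Integrating in [t] gives the bound.

    For everything to be a finite sum, [S] is taken finite and only the visits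
    before a fixed time are counted; truncating the time keeps the flow below 1
    and makes [u] finite.  The rest of the graph is collapsed into one vertex on
    which [u] vanishes.  Monotone limits in [S]
    and in time conclude ([expected_visits_le]): for the exit time [S] exhausts
    [A], for the occupation time it exhausts the whole graph.

    The differential equation only enters through
    [abs_continuous_ge_slope]: where [v] lies below [U], the
    monotonicity of [F] bounds [v'] from below almost everywhere, and for an
    absolutely continuous function this bounds the increments from below. *)

(** * Absolutely continuous functions with derivative bounded below *)

Lemma abs_continuous_onW {R : realType} (a b a' b' : R) (v : R -> R) :
  a <= a' -> b' <= b -> abs_continuous_on a b v -> abs_continuous_on a' b' v.
Proof.
move=> aa bb acv e /acv [dl dl0 H]; exists dl => // n l r lr.
by apply: H => i; have [? ? ?] := lr i; split=> //; lra.
Qed.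

Lemma abs_continuous_on_modulus {R : realType} {a b : R} {v : R -> R} :
  abs_continuous_on a b v -> forall e : R, 0 < e -> exists2 dl : R, 0 < dl &
  forall s t : R, a <= s -> s <= t -> t <= b -> t - s < dl -> `|v t - v s| < e.
Proof.
move=> acv e /acv [dl dl0 H]; exists dl => // s t sa st tb tsd.
have := H 1%N (fun=> s) (fun=> t).
rewrite !big_ord1; apply => //.
by move=> i j; rewrite !ord1.
Qed.

Section AbsoluteContinuity.
Context {R : realType}.
Implicit Types (L : seq (R * R)) (v : R -> R) (O : set R).
Let mu : measure _ _ := @lebesgue_measure R.

(** A list of intervals instead of a family indexed by [I_n], so that one more
    interval can be put in front; the most recent interval lies rightmost. *)
Definition disjoint_family a b L :=
  all (fun i : R * R => (a <= i.1) && (i.1 <= i.2) && (i.2 <= b)) L &&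
  pairwise (fun i j : R * R => j.2 <= i.1) L.

Lemma abs_continuous_on_seq a b v : abs_continuous_on a b v ->
  forall e, 0 < e -> exists2 dl, 0 < dl & forall L, disjoint_family a b L ->
    \sum_(i <- L) (i.2 - i.1) < dl -> \sum_(i <- L) `|v i.2 - v i.1| < e.
Proof.
move=> acv e /acv [dl dl0 H]; exists dl => // L /andP[/allP abL pL] sL.
have := H (size L) (fun i => (nth (0, 0) L i).1) (fun i => (nth (0, 0) L i).2).
rewrite -(big_mkord xpredT (fun i => (nth (0, 0) L i).2 - (nth (0, 0) L i).1)).
rewrite -(big_mkord xpredT
  (fun i => `|v (nth (0, 0) L i).2 - v (nth (0, 0) L i).1|)).
rewrite -(big_nth (0, 0) xpredT (fun i => i.2 - i.1)).
rewrite -(big_nth (0, 0) xpredT (fun i => `|v i.2 - v i.1|)).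
apply=> // [i|i j ij].
  by have /abL/andP[/andP[]] := mem_nth (0, 0) (ltn_ord i).
move/(pairwiseP (0, 0)) : pL => pL.
have [lij|lji|/val_inj eij] := ltngtP (i : nat) j.
- by right; apply: pL => //; rewrite inE.
- by left; apply: pL => //; rewrite inE.
- by rewrite eij eqxx in ij.
Qed.

(** The increment of [v] on [[a, s]] is at least [- c (s - a)], except for what [v]
    varies on finitely many disjoint intervals whose total length is controlled
    by the measure of [O].  With [O] a small open set around the points where [v]
    has no good derivative, absolute continuity makes that variation small. *)
Definition covered_deficit v c a O s := exists L,
  [/\ disjoint_family a s L,
      ((\sum_(i <- L) (i.2 - i.1))%:E <= mu (O `&` `[a, s]))%E &
      v a - c * (s - a) - \sum_(i <- L) `|v i.2 - v i.1| <= v s].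

Lemma covered_deficit_refl v c a O : measurable O -> covered_deficit v c a O a.
Proof.
move=> mO; exists [::]; split => //; first by rewrite big_nil.
by rewrite big_nil; lra.
Qed.

Lemma disjoint_familyW a b b' L : b <= b' ->
  disjoint_family a b L -> disjoint_family a b' L.
Proof.
move=> bb /andP[abL pL]; rewrite /disjoint_family pL andbT.
by apply: sub_all abL => i /andP[-> /le_trans->].
Qed.

Lemma covered_deficit_slope v c a O s t : measurable O -> s <= t ->
  - c * (t - s) <= v t - v s ->
  covered_deficit v c a O s -> covered_deficit v c a O t.
Proof.
move=> mO st vst [L [dL mL vL]]; exists L; split.
- exact: disjoint_familyW st dL.
- apply: le_trans mL _; apply: le_measure; rewrite ?inE.
  + by apply: measurableI.
  + by apply: measurableI.
  + apply: setIS; apply: subset_itvl; by rewrite bnd_simp.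
- nra.
Qed.

Lemma covered_deficit_subset v c a O s t : 0 <= c -> measurable O ->
  a <= s -> s <= t ->
  `[s, t]%classic `<=` O -> covered_deficit v c a O s -> covered_deficit v c a O t.
Proof.
move=> c0 mO sa st stO [L [/andP[abL pL] mL vL]]; exists ((s, t) :: L); split.
- rewrite /disjoint_family /= sa st lexx pL !andbT /=; apply/andP; split.
    by apply: sub_all abL => i /andP[-> /le_trans->].
  by apply: sub_all abL => i /andP[].
- rewrite big_cons /= EFinD.
  have -> : (t - s)%:E = mu `]s, t]%classic.
    have := lebesgue_measure_itv `]s, t] => /= ->; rewrite lte_fin.
    case: ltP => // ts; have -> : t = s by lra.
    by rewrite subrr.
  apply: (@le_trans _ _ (mu (`]s, t]%classic) + mu (O `&` `[a, s]))%E).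
    exact: leeD.
  rewrite -measureU //; last 2 first.
  + exact: measurableI.
  + apply/seteqP; split => x //= [] /=; rewrite !in_itv /=.
    by move=> /andP[sx _] [_ /andP[_ xs]]; lra.
  apply: le_measure; rewrite ?inE.
  + by apply: measurableU => //; exact: measurableI.
  + exact: measurableI.
  + move=> x [|[Ox]] /=; rewrite !in_itv /=.
      move=> /andP[sx xt]; split; last by apply/andP; split; lra.
      by apply: stO; rewrite /= in_itv /=; apply/andP; split; lra.
    by move=> /andP[ax xs]; split=> //; apply/andP; split; lra.
- rewrite big_cons /=.
  have := ler_norm (v s - v t); rewrite distrC => h.
  have : 0 <= c * (t - s) by rewrite mulr_ge0 // subr_ge0.
  nra.
Qed.

(** The supremum of the points of [[a, b]] that satisfy [S] satisfies it
    and cannot be smaller than [b]. *)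
Lemma real_induction (a b : R) (S : R -> Prop) : a <= b -> S a ->
  (forall z, a <= z -> z <= b -> exists2 eta, 0 < eta &
    forall s t, a <= s -> s <= z -> z <= t -> t <= b -> z - s < eta ->
      t - z < eta -> S s -> S t) ->
  S b.
Proof.
move=> ab Sa step.
pose E := [set s | S s /\ a <= s <= b].
have Ea : E a by split=> //; rewrite lexx.
have hE : has_sup E.
  by split; [exists a|exists b => s [_ /andP[]]].
set z := sup E.
have az : a <= z by apply: ub_le_sup => //; case: hE.
have zb : z <= b by apply: sup_le_ub; [exists a|move=> s [_ /andP[]]].
have [eta eta0 Hz] := step z az zb.
have [s [Ss /andP[sa sb]] zs] := sup_adherent eta0 hE.
have sz : s <= z by apply: ub_le_sup => //; [case: hE|split=> //; rewrite sa].
pose t := Num.min b (z + eta / 2).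
have zt : z <= t by rewrite /t le_min zb /=; lra.
have tb : t <= b by rewrite /t ge_min lexx.
have tz : t - z < eta.
  have : t <= z + eta / 2 by rewrite /t ge_min lexx orbT.
  lra.
have St : S t by apply: (Hz s t) => //; rewrite /z; lra.
have : t <= z.
  apply: ub_le_sup => //; [by case: hE|split=> //; rewrite tb andbT; lra].
move=> tz'.
have [tE|tE] : t = b \/ t = z + eta / 2 by rewrite /t; case: leP; [left|right].
  by rewrite -tE.
by move: tz'; rewrite tE; lra.
Qed.

(** The secant may straddle [z], which is the form in which the induction along
    [[a, b]] uses a derivative at [z]: both halves of the secant have slope above
    [- c]. *)
Lemma is_derive_slope (v : R -> R) (z D c : R) : is_derive z 1 v D ->
  - c < D -> exists2 eta, 0 < eta & forall s t, s <= z -> z <= t ->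
    z - s < eta -> t - z < eta -> - c * (t - s) <= v t - v s.
Proof.
move=> [dv vD] cD.
move: dv; rewrite /derivable => dv.
have : (fun h : R => h^-1 *: (v (h *: 1 + z) - v z)) @ 0^' --> D.
  by rewrite -vD; exact: dv.
move=> /cvgrPdist_lt /(_ (D + c)).
have Dc : 0 < D + c by lra.
move=> /(_ Dc); rewrite near_withinE => /nbhs_ballP [eta /= eta0 H].
exists eta => // s t sz zt zs tz.
have key h : h != 0 -> `|h| < eta -> - c < h^-1 * (v (h + z) - v z).
  move=> h0 he; have := H h; rewrite /ball /= sub0r normrN.
  move=> /(_ he h0); rewrite /GRing.scale /= mulr1 => /ltr_normlP []; lra.
have kt : - c * (t - z) <= v t - v z.
  have [->|tz0] := eqVneq t z; first by lra.
  have t0 : 0 < t - z by rewrite subr_gt0 lt_neqAle eq_sym tz0.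
  have /key : t - z != 0 by rewrite gt_eqF.
  rewrite subrK gtr0_norm // => /(_ tz).
  by rewrite mulrC ltr_pdivlMr // => /ltW.
have ks : - c * (z - s) <= v z - v s.
  have [->|sz0] := eqVneq s z; first by lra.
  have s0 : s - z < 0 by rewrite subr_lt0 lt_neqAle sz0.
  have /key : s - z != 0 by rewrite lt_eqF.
  rewrite subrK ltr0_norm // opprB => /(_ zs).
  rewrite mulrC ltr_ndivlMr //; lra.
nra.
Qed.

(** Cover the exceptional null set, together with the endpoints, by an open set [O]
    of measure less than the modulus of absolute continuity for [e].  Near a point
    of [O] the increment of [v] is charged to [O]; near any other point the
    derivative gives slope at least [- (c + e)].  Real induction carries
    [covered_deficit] from [a] to [b], with total error [e]. *)
Lemma abs_continuous_ge_slope (a b c : R) v (D : R -> R) : a <= b -> 0 <= c ->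
  abs_continuous_on a b v ->
  {ae mu, forall s, a < s < b -> is_derive s 1 v (D s)} ->
  (forall s, a < s < b -> - c <= D s) ->
  - c * (b - a) <= v b - v a.
Proof.
move=> ab c0 acv [N [mN N0 subN]] Dc.
suff H e : 0 < e -> v a - (c + e) * (b - a) - e <= v b.
  apply/ler_addgt0Pl => e e0.
  have k : 0 < b - a + 1 by lra.
  have := H (e / (b - a + 1)); rewrite divr_gt0 // => /(_ isT).
  have : e / (b - a + 1) * (b - a + 1) = e by rewrite divfK // gt_eqF.
  set q := e / _; nra.
move=> e0.
have [dl dl0 Hdl] := abs_continuous_on_seq _ _ _ acv _ e0.
pose N' := N `|` ([set a] `|` [set b]).
have mN' : measurable N' by do 2 apply: measurableU => //.
have N'0 : mu N' = 0%E.
  rewrite /N' measureU0 //; first by apply: measurableU.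
  by rewrite measureU0 //; exact: lebesgue_measure_set1.
have finN : (mu N' < +oo)%E by rewrite N'0 ltry.
have [ O [oO NO mON]] := lebesgue_regularity_outer mN' finN dl0.
have mO : measurable O by exact: open_measurable.
have mO' : (mu O < dl%:E)%E.
  have mOD : measurable (O `\` N') by exact: measurableD.
  have muE : mu (O `\` N' `|` N') = mu (O `\` N') by rewrite measureU0.
  apply: le_lt_trans mON; rewrite -muE.
  apply: le_measure; rewrite ?inE //; first by apply: measurableU.
  by move=> x Ox; have [|] := pselect (N' x); [right|left].
have [L [dL mL vL]] : covered_deficit v (c + e) a O b.
  apply: (@real_induction a b) => //; first exact: covered_deficit_refl.
  move=> z az zb.
  have [Oz|nOz] := pselect (O z).
    have /nbhs_ballP [eta /= eta0 Heta] : nbhs z O by exact: open_nbhs_nbhs.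
    exists eta => // s t sa sz zt tb zs tz.
    apply: covered_deficit_subset => //; [lra|lra|].
    move=> x /=; rewrite in_itv /= => /andP[sx xt]; apply: Heta.
    by rewrite /ball /= ltr_norml; apply/andP; split; lra.
  have nN'z : ~ N' z by move=> /NO.
  have [zb' za'] : z <> b /\ z <> a.
    by split=> ze; apply: nN'z; right; [right|left].
  have azb : a < z < b.
    by apply/andP; rewrite !lt_neqAle az zb !andbT eq_sym; split; apply/eqP.
  have dz : is_derive z 1 v (D z).
    by apply: contrapT => /= nd; apply: nN'z; left; apply: subN => /= /(_ azb).
  have [|eta eta0 Heta] := is_derive_slope v z (D z) (c + e) dz.
    by have := Dc z azb; lra.
  exists eta => // s t sa sz zt tb zs tz.
  by apply: covered_deficit_slope => //; [lra|exact: Heta].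
have : \sum_(i <- L) `|v i.2 - v i.1| < e.
  apply: Hdl => //; rewrite -lte_fin; apply: le_lt_trans mL _.
  apply: le_lt_trans mO'; apply: le_measure; rewrite ?inE //.
  exact: measurableI.
lra.
Qed.

End AbsoluteContinuity.

(** * Comparison with a solution of the differential equation *)

(** Let [z] be the last point up to [t] where [U <= v].  Beyond [z] one has
    [v < U <= V z], hence [v' >= - (C F(V z))^2] almost everywhere since [F] is
    nondecreasing, while [U] decreases at least at that rate just to the right of
    [z]: so [U <= v] slightly beyond [z], a contradiction.  The slope
    condition on [U] looks only to the right of a point, which allows downward
    jumps. *)
Lemma ode_comparison {R : realType} (F : R -> R) (C a : R) (v U V : R -> R) :
  isoperimetric_function F -> 0 < C -> 0 <= a ->
  satisfies_ode F C v -> (forall b, a <= b -> abs_continuous_on a b v) ->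
  (forall s t, s <= t -> U t <= U s) ->
  (forall s, a <= s -> 0 < U s -> U s <= V s /\ exists2 eta, 0 < eta &
     forall t, s <= t -> t - s < eta ->
       U t <= U s - (C * F (V s)) ^+ 2 * (t - s)) ->
  U a <= v a ->
  forall t, a <= t -> U t <= Num.max (v t) 0.
Proof.
move=> [F0 Fmono Fpos] C0 a0 odev acv Umono Uloc Uva t at_.
rewrite leNgt; apply/negP; rewrite gt_max => /andP[vUt Ut0].
pose E := [set s | a <= s <= t /\ U s <= v s].
have Ea : E a by split=> //; rewrite lexx.
have hE : has_sup E by split; [exists a|exists t => s [/andP[]]].
pose z := sup E.
have az : a <= z by apply: ub_le_sup => //; case: hE.
have zt : z <= t by apply: sup_le_ub; [exists a|move=> s [/andP[]]].
have act := acv t at_.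
(* [U] is nonincreasing and [v] is continuous from the left *)
have Uvz : U z <= v z.
  apply/ler_addgt0Pl => e e0.
  have [dl dl0 Hdl] := abs_continuous_on_modulus act _ e0.
  have [s [/andP[sa st] Usv] zs] := sup_adherent dl0 hE.
  have sz : s <= z by apply: ub_le_sup => //; [case: hE|split=> //; rewrite sa].
  have /ltr_normlP[] := Hdl s z sa sz zt ltac:(rewrite /z; lra).
  by have := Umono s z sz; lra.
have ztl : z < t.
  by rewrite lt_neqAle zt andbT; apply/eqP => ze; move: Uvz; rewrite ze; lra.
have after s : z < s -> s <= t -> v s < U s.
  move=> zs st; rewrite ltNge; apply/negP => Usv.
  have : s <= z.
    by apply: ub_le_sup; [case: hE|split=> //; rewrite st andbT; lra].
  lra.
have Uz0 : 0 < U z by have := Umono z t zt; lra.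
have vz0 : 0 < v z by lra.
have [UVz [eta eta0 Heta]] := Uloc z az Uz0.
have [dl dl0 Hdl] := abs_continuous_on_modulus act _ vz0.
pose s := z + Num.min (t - z) (Num.min eta dl) / 2.
have tz0 : 0 < t - z by lra.
set q := Num.min _ _ in s.
have q0 : 0 < q by rewrite !lt_min tz0 eta0 dl0.
have [qt qe qd] : [/\ q <= t - z, q <= eta & q <= dl].
  by rewrite /q; split; rewrite !ge_min lexx ?orbT.
set c := (C * F (V z)) ^+ 2 in Heta.
have : - c * (s - z) <= v s - v z.
  apply: (@abs_continuous_ge_slope _ z s c v (fun s => - (C * F (v s)) ^+ 2)).
  - by rewrite /s; lra.
  - exact: sqr_ge0.
  - by apply: abs_continuous_onW act => //; rewrite /s; lra.
  - have [N [mN N0 subN]] := odev; exists N; split => //.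
    apply: subset_trans subN => r /= + Hr; apply => /andP[zr rs].
    apply: Hr; first lra.
    have /ltr_normlP[] := Hdl z r az ltac:(lra) ltac:(rewrite /s in rs; lra)
      ltac:(rewrite /s in rs; lra).
    lra.
  - move=> r /andP[zr rs]; rewrite lerN2 /c.
    have rt : r <= t by rewrite /s in rs; lra.
    have vr0 : 0 < v r.
      have /ltr_normlP[] := Hdl z r az ltac:(lra) rt ltac:(rewrite /s in rs; lra).
      lra.
    have vrV : v r <= V z by have := after r zr rt; have := Umono z r (ltW zr); lra.
    rewrite ler_sqr ?nnegrE; first by rewrite ler_pM2l // Fmono // ltW.
    + by apply: mulr_ge0; [exact: ltW|apply: F0; exact: ltW].
    + by apply: mulr_ge0; [exact: ltW|apply: F0; lra].
have := Heta s ltac:(rewrite /s; lra) ltac:(rewrite /s; lra).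
have := after s ltac:(rewrite /s; lra) ltac:(rewrite /s; lra).
lra.
Qed.

(** * Edge profiles *)

Section Profile.
Context {R : realType}.
Implicit Types a b s t : R.

(** The fraction of the segment between [a] and [b] that lies above [t], in a form
    whose integral over [t] is read off from that of the positive parts; a
    degenerate segment is a point mass. *)
Definition above a b t : R :=
  if a == b then (t < a)%R%:R
  else (Num.max (a - t) 0 - Num.max (b - t) 0) / (a - b).

Lemma aboveC a b t : above a b t = above b a t.
Proof.
rewrite /above eq_sym; have [->//|ba] := eqVneq b a.
have ab0 : a - b != 0 by rewrite subr_eq0 eq_sym.
have ba0 : b - a != 0 by rewrite subr_eq0.
by field; apply/andP.
Qed.

Lemma above_itv a b t : 0 <= above a b t <= 1.
Proof.
wlog ba : a b / b <= a => [H|].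
  by have [/H//|/ltW/H] := leP b a; rewrite aboveC.
rewrite /above; case: eqVneq => [_|ab]; first by case: ltP; rewrite ?lexx ler01.
have ab0 : 0 < a - b by rewrite subr_gt0 lt_neqAle eq_sym ab.
apply/andP; split; last first.
  by rewrite ler_pdivrMr // mul1r; case: (leP (a - t)); case: (leP (b - t)); lra.
by apply: divr_ge0; [case: (leP (a - t)); case: (leP (b - t)); lra|exact: ltW].
Qed.

Lemma above_ge0 a b t : 0 <= above a b t.
Proof. by case/andP: (above_itv a b t). Qed.

Lemma above_le1 a b t : above a b t <= 1.
Proof. by case/andP: (above_itv a b t). Qed.

Lemma above_le a b t : above a b t <= (t < a)%R%:R + (t < b)%R%:R.
Proof.
have := above_le1 a b t.
case: (ltP t a) => ta; case: (ltP t b) => tb /=; try lra.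
move=> _; rewrite /above; case: eqVneq => [_|_].
  by rewrite ltNge ta /=; lra.
by rewrite !max_r ?subr_le0 // subrr mul0r addr0.
Qed.

Lemma above_nincr a b s t : s <= t -> above a b t <= above a b s.
Proof.
move=> st; wlog ba : a b / b <= a => [H|].
  by have [/H//|/ltW/H] := leP b a; rewrite ![above b a _]aboveC.
rewrite /above; case: eqVneq => [_|ab].
  by case: (ltP t a) => // ta; rewrite (le_lt_trans st ta).
have ab0 : 0 < a - b by rewrite subr_gt0 lt_neqAle eq_sym ab.
rewrite ler_pM2r ?invr_gt0 //.
case: (leP (a - t)); case: (leP (b - t)); case: (leP (a - s)); case: (leP (b - s)); lra.
Qed.

Lemma above_crossing a b s t : b <= s -> s <= t -> t < a ->
  above a b s - above a b t = (t - s) / (a - b).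
Proof.
move=> bs st ta; rewrite /above gt_eqF; last by lra.
rewrite -mulrBl; congr (_ / _).
case: (leP (a - t)); case: (leP (b - t)); case: (leP (a - s)); case: (leP (b - s)); lra.
Qed.

Lemma measurable_above (D : set R) a b : measurable_fun D (above a b).
Proof.
rewrite /above; case: eqVneq => _.
  apply: measurable_funTS; apply: measurableT_comp => //.
  exact: measurable_fun_ltr.
apply: measurable_funM => //; apply: measurable_funB; apply: measurable_maxr => //;
  exact: measurable_funB.
Qed.

Local Notation mu := (@lebesgue_measure R).

Lemma integral_pos_part a : 0 <= a ->
  (\int[mu]_(t in `[0%R, +oo[) (Num.max (a - t) 0)%:E = (a ^+ 2 / 2)%:E)%E.
Proof.
move=> a0.
transitivity (\int[mu]_(t in `[0%R, a]) (a - t)%:E)%E.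
  have sub : (`[0, a] `<=` `[0%R, +oo[)%classic by apply: subset_itvl; rewrite bnd_simp.
  rewrite -[in RHS](setIidr sub).
  rewrite integral_mkcondr; apply: eq_integral => t; rewrite inE /= in_itv /= andbT => t0.
  rewrite patchE mem_setE in_itv /= t0 /=; case: leP => ta.
    by rewrite max_l // subr_ge0.
  by rewrite max_r // subr_le0 ltW.
have [->|a0'] := eqVneq a 0.
  by rewrite set_itv1 integral_set1 expr0n /= mul0r.
have a00 : 0 < a by rewrite lt_neqAle eq_sym a0'.
rewrite (@continuous_FTC2 _ (fun t => a - t) (fun t => a * t - t ^+ 2 / 2)) //.
- by rewrite -EFinB; congr EFin; field.
- by apply: continuous_subspaceT => x; apply: cvgB; [exact: cvg_cst|exact: cvg_id].
- have dF x : derivable (fun t => a * t - t ^+ 2 / 2) x 1 by [].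
  have cF : continuous (fun t => a * t - t ^+ 2 / 2).
    by move=> x; apply/differentiable_continuous/derivable1_diffP.
  split => //.
  + by apply: cvg_at_right_filter; exact: cF.
  + by apply: cvg_at_left_filter; exact: cF.
- move=> x _; rewrite derive1E.
  have dF : is_derive x 1 (fun t => a * t - t ^+ 2 / 2) (a - x).
    by apply: is_derive_eq; rewrite /GRing.scale /=; field.
  by rewrite derive_val.
Qed.

Lemma integral_below a : 0 <= a ->
  (\int[mu]_(t in `[0%R, +oo[) ((t < a)%R%:R)%:E = a%:E)%E.
Proof.
move=> a0.
have sub : (`[0, a[ `<=` `[0%R, +oo[)%classic by apply: subset_itvl; rewrite bnd_simp.
transitivity (\int[mu]_(t in `[0%R, a[) (cst 1%E t))%E; last first.
  rewrite integral_cst // mul1e; have := lebesgue_measure_itv `[0, a[ => /= ->.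
  by rewrite lte_fin sube0; case: ltP => // a0'; congr EFin; lra.
rewrite -[in RHS](setIidr sub).
rewrite integral_mkcondr; apply: eq_integral => t; rewrite inE /= in_itv /= andbT => t0.
by rewrite patchE mem_setE in_itv /= t0 /=; case: ltP.
Qed.

Lemma integral_above a b : 0 <= a -> 0 <= b ->
  (\int[mu]_(t in `[0%R, +oo[) (above a b t)%:E = ((a + b) / 2)%:E)%E.
Proof.
move=> a0 b0; wlog ba : a b a0 b0 / b <= a => [H|].
  have [/H//|/ltW/H] := leP b a; first exact.
  by under eq_integral do rewrite aboveC; rewrite [a + b]addrC; exact.
have [->|ab] := eqVneq a b.
  by rewrite /above eqxx integral_below //; congr EFin; field.
have ab0 : 0 < a - b by rewrite subr_gt0 lt_neqAle eq_sym ab.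
have pp (c x : R) : ( 0 <= Num.max (c - x) 0) by rewrite le_max lexx orbT.
have mp (c : R) (D : set R) : measurable_fun D (fun t => (Num.max (c - t) 0)%:E).
  apply/measurable_EFinP; apply: measurable_maxr => //; exact: measurable_funB.
have := integral_pos_part a a0.
have -> : (\int[mu]_(t in `[0%R, +oo[) (Num.max (a - t) 0)%:E =
  \int[mu]_(t in `[0%R, +oo[)
    ((a - b)%:E * (above a b t)%:E + (Num.max (b - t) 0)%:E))%E.
  apply: eq_integral => t _; rewrite /above (negbTE ab) -EFinM -EFinD; congr EFin.
  by field; rewrite gt_eqF.
have ma (D : set R) : measurable_fun D (fun t => (above a b t)%:E).
  by apply/measurable_EFinP; exact: measurable_above.
rewrite ge0_integralD //; last 4 first.
- by move=> x _; rewrite -EFinM lee_fin mulr_ge0 ?above_ge0 // ltW.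
- by apply: measurable_funeM; exact: ma.
- by move=> x _; rewrite lee_fin.
- exact: mp.
rewrite ge0_integralZl //; last 3 first.
- exact: ma.
- by move=> x _; rewrite lee_fin above_ge0.
- by rewrite lee_fin ltW.
rewrite integral_pos_part //.
have : (0 <= \int[mu]_(t in `[0%R, +oo[) (above a b t)%:E)%E.
  by apply: integral_ge0 => x _; rewrite lee_fin above_ge0.
case: (integral _ _ _) => [x|_|//]; last by rewrite gt0_muley ?lte_fin.
move=> _ [] E; congr EFin; apply: (mulfI (lt0r_neq0 ab0)).
by apply: (addIr (b ^+ 2 / 2)); rewrite E; field.
Qed.

End Profile.

(** * Weighted networks *)

Section Network.
Context {R : realType} {I : eqType}.
Variables (r : seq I) (w : I -> I -> R).
Hypotheses (wC : forall x y, w x y = w y x) (w0 : forall x y, 0 <= w x y).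
Implicit Types (u : I -> R) (P E : pred I).

(** Inside [P] the flow is antisymmetric and cancels. *)
Lemma flow_boundary u P :
  \sum_(x <- r | P x) \sum_(y <- r) w x y * (u x - u y) =
  \sum_(x <- r | P x) \sum_(y <- r | ~~ P y) w x y * (u x - u y).
Proof.
under eq_bigr do rewrite (bigID P) /=.
rewrite big_split /= -[RHS]add0r; congr (_ + _).
set S := (X in X = 0); suff : S = - S by lra.
rewrite {1}/S exchange_big /= -sumrN; apply: eq_bigr => x _.
by rewrite -sumrN; apply: eq_bigr => y _; rewrite wC -mulrN opprB.
Qed.

(** Each crossing edge occurs in both orientations. *)
Lemma sum_ge_crossing (f : I -> I -> R) P :
  (forall x y, f x y = f y x) -> (forall x y, 0 <= f x y) ->
  2 * \sum_(x <- r | P x) \sum_(y <- r | ~~ P y) f x y <=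
  \sum_(x <- r) \sum_(y <- r) f x y.
Proof.
move=> fC f0; rewrite mulrDl mul1r.
rewrite [leRHS](bigID P) /=; apply: lerD.
  apply: ler_sum => x _; rewrite [leRHS](bigID P) /= lerDr.
  by apply: sumr_ge0.
rewrite exchange_big /=; apply: ler_sum => y _.
rewrite [leRHS](bigID P) /=; under eq_bigr do rewrite fC.
by rewrite lerDl; apply: sumr_ge0.
Qed.

Definition volume_above u t := \sum_(x <- r | t < u x) \sum_(y <- r) w x y.
Definition boundary_above u t :=
  \sum_(x <- r | t < u x) \sum_(y <- r | ~~ (t < u y)) w x y.
(** The factor [1/2] compares with [volume_above]: the total weight of the edges
    counts every vertex mass once, but up to twice the mass of [{u > t}] belongs
    to edges that reach above [t]. *)
Definition edge_volume u t :=
  2^-1 * \sum_(x <- r) \sum_(y <- r) w x y * above (u x) (u y) t.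

Lemma edge_volume_nincr u s t : s <= t -> edge_volume u t <= edge_volume u s.
Proof.
move=> st; rewrite ler_pM2l //; apply: ler_sum => x _; apply: ler_sum => y _.
by rewrite ler_wpM2l //; exact: above_nincr.
Qed.

Lemma sum_indicator_endpoints P :
  \sum_(x <- r) \sum_(y <- r) w x y * ((P x)%:R + (P y)%:R) =
  2 * \sum_(x <- r | P x) \sum_(y <- r) w x y.
Proof.
rewrite [RHS]mulrDl !mul1r.
under eq_bigr do (under eq_bigr do rewrite mulrDr; rewrite big_split /=).
rewrite big_split /=; congr (_ + _).
  rewrite [RHS]big_mkcond; apply: eq_bigr => x _ /=.
  by rewrite -big_distrl /=; case: (P x); rewrite ?mulr1 ?mulr0.
rewrite exchange_big /= [RHS]big_mkcond; apply: eq_bigr => x _ /=.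
rewrite -big_distrl /=; under eq_bigr do rewrite wC.
by case: (P x); rewrite ?mulr1 ?mulr0.
Qed.

Lemma edge_volume_le u t : edge_volume u t <= volume_above u t.
Proof.
rewrite /edge_volume ler_pdivrMl //.
rewrite -(sum_indicator_endpoints (fun x => t < u x)).
apply: ler_sum => x _; apply: ler_sum => y _.
by rewrite ler_wpM2l //; exact: above_le.
Qed.

Lemma superlevel_gap u s :
  exists2 eta : R, 0 < eta & forall x, x \in r -> s < u x -> s + eta <= u x.
Proof.
elim: r => [|x l [eta eta0 IH]]; first by exists 1.
have [sx|xs] := ltP s (u x); last first.
  exists eta => // y; rewrite inE => /predU1P[->|/IH//]; lra.
exists (Num.min eta (u x - s)); first by rewrite lt_min eta0 subr_gt0.
move=> y; rewrite inE => /predU1P[->|yl] sy.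
  have : Num.min eta (u x - s) <= u x - s by rewrite ge_min lexx orbT.
  lra.
have : Num.min eta (u x - s) <= eta by rewrite ge_min lexx.
have := IH y yl sy; lra.
Qed.

(** Up to the lowest value of [u] above [s], a crossing edge loses the fraction
    [(t - s) / (u x - u y)] of its mass, so that the slope is minus the sum of
    [w / (u x - u y)].  The Cauchy-Schwarz step uses
    [1 / h >= 2 B - B^2 h], which sums to [2 B^2 - B^2 * flow >= B^2]. *)
Lemma edge_volume_slope u s :
  \sum_(x <- r | s < u x) \sum_(y <- r) w x y * (u x - u y) <= 1 ->
  exists2 eta, 0 < eta & forall t, s <= t -> t - s < eta ->
    edge_volume u t <= edge_volume u s - boundary_above u s ^+ 2 * (t - s).
Proof.
rewrite flow_boundary => flow1.
have [eta eta0 gap] := superlevel_gap u s; exists eta => // t st tse.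
set B := boundary_above u s.
pose d x y := above (u x) (u y) s - above (u x) (u y) t.
pose f x y := w x y * d x y.
have f0 x y : 0 <= f x y by rewrite mulr_ge0 // subr_ge0 above_nincr.
have fC x y : f x y = f y x by rewrite /f wC /d ![above (u x) _ _]aboveC.
suff : B ^+ 2 * (t - s) <= edge_volume u s - edge_volume u t by lra.
have -> : edge_volume u s - edge_volume u t = 2^-1 * \sum_(x <- r) \sum_(y <- r) f x y.
  rewrite /edge_volume -mulrBr -sumrB; congr (_ * _); apply: eq_bigr => x _.
  by rewrite -sumrB; apply: eq_bigr => y _; rewrite -mulrBr.
rewrite ler_pdivlMl //.
apply: le_trans (sum_ge_crossing _ (fun x => s < u x) fC f0).
rewrite ler_pM2l //.
pose g x y := w x y * ((2 * B - B ^+ 2 * (u x - u y)) * (t - s)).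
apply: (@le_trans _ _ (\sum_(x <- r | s < u x) \sum_(y <- r | ~~ (s < u y)) g x y)).
  have -> : \sum_(x <- r | s < u x) \sum_(y <- r | ~~ (s < u y)) g x y =
      (2 * B * B - B ^+ 2 * (\sum_(x <- r | s < u x)
        \sum_(y <- r | ~~ (s < u y)) w x y * (u x - u y))) * (t - s).
    have gE x y : g x y = 2 * B * (t - s) * w x y -
        B ^+ 2 * (t - s) * (w x y * (u x - u y)) by rewrite /g; ring.
    under eq_bigr do (under eq_bigr do rewrite gE; rewrite sumrB -!mulr_sumr).
    rewrite sumrB -!mulr_sumr -/(boundary_above u s) -/B; ring.
  rewrite ler_wpM2r ?subr_ge0 //.
  have := sqr_ge0 B; nra.
rewrite big_seq_cond [leRHS]big_seq_cond; apply: ler_sum => x /andP[xr sx].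
apply: ler_sum => y; rewrite -leNgt => ys.
rewrite /g /f ler_wpM2l // /d above_crossing //; last by have := gap x xr sx; lra.
rewrite mulrC ler_wpM2l ?subr_ge0 //.
have xy0 : 0 < u x - u y by lra.
rewrite -[(_)^-1]mul1r ler_pdivlMr //.
have := sqr_ge0 (B * (u x - u y) - 1); rewrite sqrrB; nra.
Qed.

(** The second bound holds because the edges that touch [E] have total weight at
    most twice the vertex mass of [E]. *)
Lemma sum_edge_profile u (E : pred I) t :
  \sum_(x <- r) \sum_(y <- r | E x || E y) w x y * above (u x) (u y) t <=
  2 * Num.min (edge_volume u t) (\sum_(x <- r | E x) \sum_(y <- r) w x y).
Proof.
rewrite minr_pMr // le_min; apply/andP; split.
  rewrite /edge_volume mulrA divff // mul1r; apply: ler_sum => x _.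
  rewrite big_mkcond; apply: ler_sum => y _; case: ifP => // _.
  by rewrite mulr_ge0 // above_ge0.
rewrite -sum_indicator_endpoints; apply: ler_sum => x _.
rewrite big_mkcond; apply: ler_sum => y _; case: ifP => [xy|_].
  rewrite ler_wpM2l //; apply: le_trans (above_le1 _ _ _) _.
  by move: xy; case: (E x); case: (E y) => //= _; lra.
by rewrite mulr_ge0 // addr_ge0.
Qed.

(** An edge inside [E] is met from both its ends, and an edge with one end [x] in
    [E] occurs twice with the average [(u x + u y) / 2 >= u x / 2]. *)
Lemma sum_le_edge_average u (E : pred I) : (forall x, 0 <= u x) ->
  \sum_(x <- r | E x) u x * \sum_(y <- r) w x y <=
  \sum_(x <- r) \sum_(y <- r | E x || E y) w x y * ((u x + u y) / 2).
Proof.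
move=> u0.
pose h x y := w x y * (u x * (E x)%:R).
have -> : \sum_(x <- r | E x) u x * \sum_(y <- r) w x y =
    \sum_(x <- r) \sum_(y <- r) (h x y + h y x) / 2.
  under [RHS]eq_bigr do rewrite -mulr_suml big_split /=.
  rewrite -mulr_suml big_split /= [in X in _ = (_ + X) / _]exchange_big /=.
  rewrite -mulr2n -[_ *+ 2]mulr_natr mulfK // big_mkcond; apply: eq_bigr => x _.
  by rewrite /h -mulr_suml; case: (E x); rewrite ?mulr1 ?mulr0 // mulrC.
apply: ler_sum => x _; rewrite [leRHS]big_mkcond; apply: ler_sum => y _.
rewrite /h [w y x]wC -mulrDr -mulrA.
case: ifPn => [_|]; last by rewrite negb_or => /andP[/negbTE-> /negbTE->] /=;
  rewrite !mulr0 addr0 mul0r mulr0.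
rewrite ler_wpM2l // ler_pM2r ?invr_gt0 //.
by have := u0 x; have := u0 y; case: (E x); case: (E y) => /=; lra.
Qed.

End Network.

(** * The killed walk and its potential *)

Lemma esum_seq {R : realType} {T : choiceType} (s : seq T) (Q : pred T) (a : T -> R) :
  uniq s -> (forall x, 0 <= a x) ->
  \esum_(x in [set` [seq x <- s | Q x]]) (a x)%:E = (\sum_(x <- s | Q x) a x)%:E.
Proof.
move=> us a0; rewrite esum_fset //; last by move=> x _; rewrite lee_fin.
by rewrite -fsbig_seq ?filter_uniq // sumEFin big_filter.
Qed.

Lemma le_esumZ {R : realType} {T : choiceType} (K : set T) (c : R) (a : T -> R) :
  0 <= c -> (forall x, 0 <= a x) ->
  (\esum_(x in K) (c * a x)%:E <= c%:E * \esum_(x in K) (a x)%:E)%E.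
Proof.
move=> c0 a0; apply: ge_ereal_sup => _ [X [finX XK] <-].
rewrite (_ : \sum_(x \in X) (c * a x)%:E = c%:E * \sum_(x \in X) (a x)%:E)%E.
  apply: lee_pmul => //; first by apply: fsume_ge0 => x _; rewrite lee_fin.
  by apply: esum_ge; exists X.
by rewrite ge0_mule_fsumr // => x; rewrite lee_fin.
Qed.

Section KilledWalk.
Context {R : realType} {G : countType}.
Variables (p : G -> G -> R) (m : G -> R) (o : G) (S : seq G).
Hypotheses (hp : stochastic p) (hm : reversible p m) (uS : uniq S).
Implicit Types (x y : G) (Q : pred G).

Let p0 x y : 0 <= p x y. Proof. by case: hp. Qed.
Let m0 x : 0 < m x. Proof. by case: hm. Qed.
Let mpC x y : m x * p x y = m y * p y x. Proof. by case: hm. Qed.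

Lemma esum_transition_compl Q x :
  \esum_(y in ~` [set` [seq y <- S | Q y]]) (p x y)%:E =
  (1 - \sum_(y <- S | Q y) p x y)%:E.
Proof.
have [_ /(_ x)] := hp.
rewrite (esumID [set` [seq y <- S | Q y]]); last by move=> y _; rewrite lee_fin.
rewrite !setTI esum_seq //.
case: (esum _ _) => [e [] <-|//|//].
by rewrite addrAC subrr add0r.
Qed.

Lemma sum_transition_le1 x : \sum_(y <- S) p x y <= 1.
Proof.
rewrite -subr_ge0 -lee_fin -(esum_transition_compl xpredT).
by apply: esum_ge0 => y _; rewrite lee_fin.
Qed.

(** [killed k y] is the probability that the walk is at [y] at time [k] having
    been in [S] at all earlier times; [y] itself may lie outside [S]. *)
Fixpoint killed k y : R :=
  if k is k'.+1 then \sum_(x <- S) killed k' x * p x y else (y == o)%:R.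

Lemma killed_ge0 k y : 0 <= killed k y.
Proof.
elim: k y => [|k IH] y /=; first by case: (_ == _).
by apply: sumr_ge0 => x _; rewrite mulr_ge0.
Qed.

(** The complement of [S] is collapsed into the vertex [None], whose links have the
    weights that make the total weight at [x] equal to [m x]. *)
Definition conductance (a b : option G) : R :=
  match a, b with
  | Some x, Some y => m x * p x y
  | Some x, None | None, Some x => m x - \sum_(y <- S) m x * p x y
  | None, None => 0
  end.

Definition vertices : seq (option G) := None :: [seq Some x | x <- S].

(** The expected number of visits before time [N], divided by the reversible
    measure. *)
Definition potential N (a : option G) : R :=
  if a is Some x then
    if x \in S then (\sum_(k < N) killed k x) / m x else 0
  else 0.

Lemma conductanceC a b : conductance a b = conductance b a.
Proof. by case: a b => [x|] [y|] /=. Qed.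

Lemma conductance_ge0 a b : 0 <= conductance a b.
Proof.
have dead x : 0 <= m x - \sum_(y <- S) m x * p x y.
  rewrite -mulr_sumr subr_ge0 ger_pMr //; exact: sum_transition_le1.
by case: a b => [x|] [y|] //=; rewrite mulr_ge0 // ltW.
Qed.

Lemma sum_conductance x : \sum_(b <- vertices) conductance (Some x) b = m x.
Proof. by rewrite big_cons big_map /= subrK. Qed.

Lemma potential_ge0 N a : 0 <= potential N a.
Proof.
case: a => [x|] //=; case: ifP => // _.
by rewrite divr_ge0 ?(ltW (m0 _)) // sumr_ge0 // => k _; exact: killed_ge0.
Qed.

(** Summing the recursion for [killed] over [k < N] telescopes: what is left is the
    start at [o] and the walk still alive at time [N]. *)
Lemma potential_balance N x : x \in S ->
  \sum_(b <- vertices) conductance (Some x) b * (potential N (Some x) - potential N b)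
  = (x == o)%:R - killed N x.
Proof.
move=> xS; under eq_bigr do rewrite mulrBr.
rewrite sumrB -mulr_suml sum_conductance big_cons big_map /= mulr0 add0r xS.
rewrite mulrC divfK ?gt_eqF //.
have -> : \sum_(y <- S) m x * p x y * (if y \in S then (\sum_(k < N) killed k y) / m y else 0)
   = \sum_(k < N) killed k.+1 x.
  rewrite /= exchange_big /= big_seq [RHS]big_seq; apply: eq_bigr => y ->.
  rewrite mpC -mulr_suml; have := m0 y => /lt0r_neq0 my; field.
  exact: my.
rewrite -sumrB -(big_mkord xpredT (fun k => killed k x - killed k.+1 x)).
under eq_bigr do rewrite -opprB.
by rewrite sumrN telescope_sumr // opprB.
Qed.

Lemma potential_flow_le N (Q : pred (option G)) : ~~ Q None ->
  \sum_(a <- vertices | Q a)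
     \sum_(b <- vertices) conductance a b * (potential N a - potential N b) <=
  \sum_(x <- S | Q (Some x)) (x == o)%:R.
Proof.
move=> /negbTE QN; rewrite big_cons QN big_map.
rewrite big_seq_cond [leRHS]big_seq_cond; apply: ler_sum => x /andP[xS _].
by rewrite potential_balance // lerBlDr lerDl killed_ge0.
Qed.

Lemma flow_le1 N t : 0 <= t ->
  \sum_(a <- vertices | t < potential N a)
     \sum_(b <- vertices) conductance a b * (potential N a - potential N b) <= 1.
Proof.
move=> t0; apply: le_trans (potential_flow_le N (fun a => t < potential N a) _) _.
  by rewrite -leNgt.
apply: (@le_trans _ _ (\sum_(x <- S) (x == o)%:R)).
  by rewrite big_mkcond; apply: ler_sum => x _; case: ifP.
rewrite -natr_sum (_ : \sum_(x <- S) (x == o) = count_mem o S)%N.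
  by rewrite count_uniq_mem //; case: (_ \in _).
by rewrite -sum1_count [RHS]big_mkcond; apply: eq_bigr => x _ /=; case: (_ == _).
Qed.

Definition superlevel N t : set G := [set` [seq x <- S | t < potential N (Some x)]].

Let edge : rel G := fun x y => 0 < p x y.

Let edgeC x y : edge x y = edge y x.
Proof. by rewrite /edge -(pmulr_rgt0 _ (m0 x)) mpC pmulr_rgt0. Qed.

(** [o] itself is required to be in the set, so that if it is not then no point is
    reached. *)
Definition reached N t x := superlevel N t o /\ exists s : seq G,
  [/\ path edge o s, last o s = x & forall z, z \in s -> superlevel N t z].

(** Suppose some points of the superlevel set are not joined to [o] in it.  The edges
    that leave the set of these bad points leave the superlevel set, so that the
    flow along them is outwards; but the set contains no source, so its net flow is
    at most 0 and no such edge carries weight.  By reversibility the walk never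
    enters the bad set, where [u] would then vanish. *)
Lemma superlevel_reached N t x : 0 <= t -> superlevel N t x -> reached N t x.
Proof.
move=> t0 Kx; apply: contrapT => nrx.
pose bad (a : option G) :=
  if a is Some y then `[< superlevel N t y /\ ~ reached N t y >] else false.
have inK y : superlevel N t y <-> y \in S /\ t < potential N (Some y).
  by rewrite /superlevel /= mem_filter; split=> [/andP[]|[-> ->]].
have bado : ~~ bad (Some o).
  by apply/negP => /asboolP[Ko []]; split => //; exists [::].
(* otherwise [y] would be joined to [o] through [z] *)
have leave y z : bad (Some y) -> ~~ bad (Some z) -> edge y z -> ~ superlevel N t z.
  move=> /asboolP[Ky nry] nbz yz Kz; apply: nry.
  have [Ko [s [ps ls Ks]]] : reached N t z.
    by apply: contrapT => nrz; move: nbz => /negP; apply; apply/asboolP.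
  split => //; exists (rcons s y); split.
  - by rewrite rcons_path ps ls edgeC.
  - by rewrite last_rcons.
  - by move=> c; rewrite mem_rcons inE => /predU1P[->|/Ks].
have pot_le z : ~ superlevel N t z -> potential N (Some z) <= t.
  move=> nKz; rewrite leNgt; apply/negP => tz; apply: nKz; apply/inK; split=> //.
  by move: tz; rewrite /=; case: ifP => // _; rewrite ltNge t0.
have term0 a b : bad a && ~~ bad b ->
    0 <= conductance a b * (potential N a - potential N b).
  case: a => [y|//] /andP[by_ nbb].
  have ty : t < potential N (Some y) by move/asboolP: by_ => [/inK[]].
  have [->|yb] := eqVneq (conductance (Some y) b) 0; first by rewrite mul0r.
  rewrite mulr_ge0 ?conductance_ge0 // subr_ge0.
  case: b nbb yb => [z|] nbz yz; last by rewrite /= (le_trans t0) // ltW.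
  apply: le_trans (ltW ty); apply: pot_le; apply: (leave y z by_ nbz).
  rewrite /edge lt_neqAle p0 andbT eq_sym; apply: contra_neq yz => /= ->.
  by rewrite mulr0.
have no_leak y z : y \in S -> z \in S -> bad (Some y) -> ~~ bad (Some z) -> p y z = 0.
  move=> yS zS by_ nbz; apply/eqP; rewrite -[_ == _]negbK; apply/negP => pyz.
  have yz : edge y z by rewrite /edge lt_neqAle p0 eq_sym pyz.
  have zt := pot_le _ (leave _ _ by_ nbz yz).
  have ty : t < potential N (Some y) by move/asboolP: by_ => [/inK[]].
  have := potential_flow_le N bad isT.
  rewrite flow_boundary; last exact: conductanceC.
  rewrite [leRHS]big1; last by move=> c; have [->|//] := eqVneq c o; rewrite (negbTE bado).
  have pos a : bad a -> 0 <= \sum_(b <- vertices | ~~ bad b)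
      conductance a b * (potential N a - potential N b).
    by move=> ba; apply: sumr_ge0 => b nb; rewrite term0 // ba.
  move=> le0.
  have : \sum_(a <- vertices | bad a) \sum_(b <- vertices | ~~ bad b)
      conductance a b * (potential N a - potential N b) == 0.
    by rewrite eq_le le0 sumr_ge0.
  rewrite psumr_eq0 // => /allP /(_ (Some y)).
  have inV c : c \in S -> Some c \in vertices by move=> cS; rewrite inE /= map_f.
  move=> /(_ (inV _ yS)); rewrite by_ /= psumr_eq0; last first.
    by move=> b nb; apply: (term0 (Some y) b); rewrite by_.
  move=> /allP /(_ (Some z) (inV _ zS)); rewrite nbz /= mulf_eq0 => /orP[].
    by rewrite mulf_eq0 (gt_eqF (m0 y)) (negbTE pyz).
  by rewrite gt_eqF // subr_gt0; apply: le_lt_trans ty.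
have killed0 k y : y \in S -> bad (Some y) -> killed k y = 0.
  elim: k y => [|k IH] y yS by_ /=.
    by have [ye|//] := eqVneq y o; rewrite -ye by_ in bado.
  rewrite big_seq big1 // => z zS.
  have [bz|nbz] := boolP (bad (Some z)); first by rewrite IH // mul0r.
  have pyz := no_leak y z yS zS by_ nbz.
  have := mpC y z; rewrite pyz mulr0 => /esym/eqP.
  by rewrite mulf_eq0 (gt_eqF (m0 z)) /= => /eqP ->; rewrite mulr0.
have [xS] := (inK x).1 Kx.
rewrite /= xS big1 ?mul0r; first by rewrite ltNge t0.
by move=> k _; apply: killed0 => //; apply/asboolP.
Qed.

Lemma superlevel_connected N t : 0 <= t -> connected_set p (superlevel N t).
Proof.
move=> t0 x y Kx Ky.
have [Ko [s [ps ls Ks]]] := superlevel_reached N t x t0 Kx.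
have [_ [s' [ps' ls' Ks']]] := superlevel_reached N t y t0 Ky.
exists (rev (belast o s) ++ s'); split.
- rewrite cat_path -ls rev_path; apply/andP; split.
    by rewrite (eq_path (e' := edge)) // => a b; rewrite /= edgeC.
  case: s ps ls Ks => [|c s] //= *.
  by rewrite rev_cons last_rcons.
- by rewrite last_cat -ls; case: s ps ls Ks => [|c s] //= *; rewrite rev_cons last_rcons.
- move=> z; rewrite mem_cat mem_rev => /orP[/mem_belast|/Ks'//].
  by rewrite inE => /predU1P[->|/Ks].
Qed.

Lemma vol_superlevel N t : 0 <= t ->
  vol m (superlevel N t) = (volume_above vertices conductance (potential N) t)%:E.
Proof.
move=> t0; rewrite /vol esum_seq //; last by move=> x; exact: ltW.
congr EFin; rewrite /volume_above big_cons [t < _]ltNge /= t0 /= big_map.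
by under [RHS]eq_bigr do rewrite sum_conductance.
Qed.

Lemma bdry_superlevel N t : 0 <= t ->
  (bdry p m (superlevel N t) <=
   (boundary_above vertices conductance (potential N) t)%:E)%E.
Proof.
move=> t0; rewrite /bdry /boundary_above.
rewrite big_cons [t < _]ltNge /= t0 /= big_map.
rewrite -esum_seq //; last first.
  by move=> x; apply: sumr_ge0 => b _; exact: conductance_ge0.
apply: le_esum => x _.
apply: le_trans (le_esumZ _ _ _ _ _) _ => //; first exact: ltW.
rewrite esum_transition_compl -EFinM lee_fin.
rewrite big_cons /= -leNgt t0 big_map /=.
rewrite [\sum_(y <- S) _](bigID (fun y => t < potential N (Some y))) /=.
by rewrite opprD addrA subrK mulrBr mulr1 mulr_sumr.
Qed.

End KilledWalk.

(** * The Green function bound *)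

(** The truncated solutions and the exit time enter only as the larger or the
    smaller of two integrands.  Since the integral of a nonnegative function is a
    supremum over the simple functions below it, it is monotone on all functions. *)
Lemma ge0_le_integral_nonmeasurable d (T : measurableType d) (R : realType)
    (mu : {measure set T -> \bar R}) (D : set T) (f g : T -> \bar R) :
  (forall x, D x -> 0 <= f x)%E -> (forall x, D x -> f x <= g x)%E ->
  (\int[mu]_(x in D) f x <= \int[mu]_(x in D) g x)%E.
Proof.
move=> f0 fg.
have g0 x : D x -> (0 <= g x)%E by move=> Dx; apply: le_trans (f0 x Dx) (fg x Dx).
rewrite !ge0_integralE //; apply: le_ereal_sup => _ [h hf <-]; exists h => //= x.
apply: le_trans (hf x) _; rewrite !patchE; case: ifPn => //.
by rewrite inE => /fg.
Qed.

Lemma ge0_subset_integral_nonmeasurable d (T : measurableType d) (R : realType)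
    (mu : {measure set T -> \bar R}) (D E : set T) (f : T -> \bar R) :
  D `<=` E -> (forall x, E x -> 0 <= f x)%E ->
  (\int[mu]_(x in D) f x <= \int[mu]_(x in E) f x)%E.
Proof.
move=> DE f0; rewrite integral_mkcond [leRHS]integral_mkcond.
apply: ge0_le_integral_nonmeasurable => x _; rewrite !patchE.
  by case: ifPn => //; rewrite inE => /DE/f0.
case: ifPn => [|_]; rewrite ?inE.
  by move=> Dx; rewrite mem_set //; exact: DE.
by case: ifPn => //; rewrite inE => /f0.
Qed.

Section GreenBound.
Context {R : realType} {G : countType}.
Variables (p : G -> G -> R) (m : G -> R) (o : G) (S : seq G).
Hypotheses (hp : stochastic p) (hm : reversible p m) (uS : uniq S).
Variables (A : set G) (N : nat).

Let w := conductance p m S.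
Let V := vertices S.
Let u := potential p m o S N.
Let inA (a : option G) := if a is Some x then `[< A x >] else false.
Let wC := conductanceC p m S hm.
Let w_ge0 := conductance_ge0 p m S hp hm uS.

Let m0 x : 0 < m x. Proof. by case: hm. Qed.

(** Layer-cake formula over the edges that touch [A]: each segment has the integral
    [(u x + u y) / 2] of its profile, and the sum of the profiles is pointwise at
    most twice the minimum. *)
Lemma killed_sum_le_integral (g : R -> \bar R) :
  (forall t, 0 < t ->
    ((Num.min (edge_volume V w u t) (\sum_(x <- S | `[< A x >]) m x))%:E <= g t)%E) ->
  ((\sum_(x <- S | `[< A x >]) \sum_(k < N) killed p o S k x)%:E <=
    2%:E * \int[lebesgue_measure]_(t in `]0%R, +oo[) g t)%E.
Proof.
move=> Hg.
have volA : \sum_(a <- V | inA a) \sum_(b <- V) w a b = \sum_(x <- S | `[< A x >]) m x.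
  rewrite [LHS]big_cons /= big_map; apply: eq_bigr => x _; exact: sum_conductance.
have greenA : \sum_(a <- V | inA a) u a * \sum_(b <- V) w a b =
    \sum_(x <- S | `[< A x >]) \sum_(k < N) killed p o S k x.
  rewrite [LHS]big_cons /= big_map big_seq_cond [RHS]big_seq_cond.
  apply: eq_bigr => x /andP[xS _].
  by rewrite sum_conductance /u /= xS divfK // gt_eqF.
rewrite -greenA.
pose W t := \sum_(a <- V) \sum_(b <- V | inA a || inA b) w a b * above (u a) (u b) t.
have u0 a : 0 <= u a by exact: potential_ge0.
apply: (@le_trans _ _
    (\sum_(a <- V) \sum_(b <- V | inA a || inA b) w a b * ((u a + u b) / 2))%:E).
  by rewrite lee_fin; apply: sum_le_edge_average.
have mabove (D : set R) a b :
    measurable_fun D (fun t => (w a b)%:E * (above (u a) (u b) t)%:E)%E.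
  by apply: measurable_funeM; apply/measurable_EFinP; exact: measurable_above.
have above0 a b t : (0 <= (w a b)%:E * (above (u a) (u b) t)%:E)%E.
  by rewrite -EFinM lee_fin mulr_ge0 ?above_ge0.
have WE t : ((W t)%:E = \sum_(a <- V) \sum_(b <- [seq b <- V | inA a || inA b])
    (w a b)%:E * (above (u a) (u b) t)%:E)%E.
  rewrite /W -sumEFin; apply: eq_bigr => a _; rewrite -sumEFin big_filter.
  by apply: eq_bigr => b _; rewrite EFinM.
have mW (D : set R) : measurable_fun D (fun t => (W t)%:E).
  under eq_fun do rewrite WE.
  by apply: emeasurable_sum => a; apply: emeasurable_sum => b; exact: mabove.
have -> : ((\sum_(a <- V) \sum_(b <- V | inA a || inA b) w a b * ((u a + u b) / 2))%:E
    = \int[lebesgue_measure]_(t in `[0%R, +oo[) (W t)%:E)%E.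
  under [RHS]eq_integral do rewrite WE.
  rewrite ge0_integral_sum //; last 2 first.
  - by move=> a; apply: emeasurable_sum => b; exact: mabove.
  - by move=> a t _; apply: sume_ge0 => b _; exact: above0.
  rewrite -sumEFin; apply: eq_bigr => a _.
  rewrite ge0_integral_sum //; last by move=> b; exact: mabove.
  rewrite big_filter -sumEFin; apply: eq_bigr => b _.
  rewrite ge0_integralZl //.
  - by rewrite integral_above.
  - by apply/measurable_EFinP; exact: measurable_above.
  - by move=> t _; rewrite lee_fin above_ge0.
  - by rewrite lee_fin.
rewrite -integral_itv_obnd_cbnd; last exact: mW.
have -> : (\int[lebesgue_measure]_(t in `]0%R, +oo[) (W t)%:E =
    2%:E * \int[lebesgue_measure]_(t in `]0%R, +oo[) (2^-1 * W t)%:E)%E.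
  rewrite -ge0_integralZl //.
  - by apply: eq_integral => t _; rewrite -EFinM mulrA divff // mul1r.
  - apply/measurable_EFinP; apply: measurable_funM => //.
    by apply/measurable_EFinP; exact: mW.
  - move=> t _; rewrite lee_fin mulr_ge0 //; do 2 apply: sumr_ge0 => ? _.
    by rewrite mulr_ge0 ?above_ge0.
rewrite lee_pmul2l //; apply: ge0_le_integral_nonmeasurable => t /=; rewrite in_itv /= andbT => t0.
  rewrite lee_fin mulr_ge0 //; do 2 apply: sumr_ge0 => ? _.
  by rewrite mulr_ge0 ?above_ge0.
apply: le_trans (Hg t t0); rewrite lee_fin -volA ler_pdivrMl //.
exact: sum_edge_profile.
Qed.

Variables (F : R -> R) (C : R).
Hypotheses (hF : isoperimetric_function F) (hiso : anchored_isoperimetric p m o F C).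

Lemma edge_volume0_le : edge_volume V w u 0 <= \sum_(x <- S) m x.
Proof.
apply: le_trans (edge_volume_le V w wC w_ge0 _ _) _.
rewrite /volume_above big_mkcond /= [leLHS]big_cons /= ltxx add0r big_map.
apply: ler_sum => x _; rewrite sum_conductance; case: ifP => // _; exact: ltW.
Qed.

(** [edge_volume] satisfies the hypotheses of [ode_comparison].  As long as it is
    positive the superlevel set is nonempty, hence connected and containing [o],
    and the isoperimetric inequality turns [edge_volume_slope] into the slope
    condition. *)
Lemma edge_volume_le_ode (v : R -> R) a : 0 <= a -> satisfies_ode F C v ->
  (forall b, a <= b -> abs_continuous_on a b v) ->
  \sum_(x <- S) m x <= v a ->
  forall t, a <= t -> edge_volume V w u t <= Num.max (v t) 0.
Proof.
move=> a0 odev acv va; have [C0 iso] := hiso; have [F0 Fmono _] := hF.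
apply: (ode_comparison F C a v _ (volume_above V w u)) => //.
- by move=> s t; apply: edge_volume_nincr.
- move=> s as_ Us.
  have s0 : 0 <= s by exact: le_trans as_.
  have UV := edge_volume_le V w wC w_ge0 u s; split => //.
  have V0 : 0 < volume_above V w u s by exact: lt_le_trans Us UV.
  have [x Kx] : superlevel p m o S N s !=set0.
    apply/set0P/eqP => K0.
    have := vol_superlevel p m o S hm uS N s s0.
    by rewrite K0 /vol esum_set0 => -[] /esym; apply/eqP; rewrite gt_eqF.
  have [Ko _] := superlevel_reached p m o S hp hm uS N s x s0 Kx.
  have conn := superlevel_connected p m o S hp hm uS N s s0.
  have isoK : C * F (volume_above V w u s) <= boundary_above V w u s.
    rewrite -lee_fin; apply: le_trans (bdry_superlevel p m o S hp hm uS N s s0).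
    have := iso _ conn Ko; rewrite vol_superlevel //= ltry; exact.
  have [eta eta0 Heta] := edge_volume_slope V w wC w_ge0 u s
    (flow_le1 p m o S hp hm uS N s s0).
  exists eta => // t st tse; apply: le_trans (Heta t st tse) _.
  rewrite lerD2l lerN2 ler_wpM2r ?subr_ge0 //.
  have CF0 : 0 <= C * F (volume_above V w u s).
    by rewrite mulr_ge0 ?F0 // ltW.
  by rewrite ler_sqr ?nnegrE // (le_trans CF0).
- apply: le_trans va; apply: le_trans edge_volume0_le.
  exact: edge_volume_nincr.
Qed.

End GreenBound.

(** * Trajectories of the walk *)

Section Probability.
Context {R : realType} {G : countType} {d : measure_display}
  {Omega : measurableType d}.
Variables (P : probability Omega R) (X : nat -> Omega -> G).
Variables (p : G -> G -> R) (o : G).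
Hypothesis hX : markov_chain_from P X p o.
Hypothesis hp : stochastic p.

Definition trajectories_in (B : nat -> set G) : set Omega :=
  [set w | forall k, B k (X k w)].

Lemma measurable_trajectories_in B : measurable (trajectories_in B).
Proof.
have [mX _ _] := hX.
rewrite (_ : trajectories_in B = \bigcap_k (X k @^-1` B k)).
  by apply: bigcapT_measurable => k; exact: mX.
by apply/seteqP; split=> w /= Bw; [move=> k _|move=> k]; exact: Bw.
Qed.

Lemma measure_le_sum (I : eqType) (s : seq I) (D : set Omega) (E : I -> set Omega) :
  measurable D -> (forall i, measurable (E i)) ->
  (forall w, D w -> exists2 i, i \in s & E i w) ->
  (P D <= \sum_(i <- s) P (E i))%E.
Proof.
elim: s D => [|i s IH] D mD mE DE.
  rewrite big_nil (_ : D = set0) ?measure0 //.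
  by apply/seteqP; split=> // w /DE[].
rewrite big_cons; apply: (@le_trans _ _ (P (E i) + P (D `\` E i))%E); last first.
  rewrite leeD2l //; apply: IH => //; first exact: measurableD.
  move=> w [/DE[j]]; rewrite inE => /predU1P[-> //|js Ej _].
  by exists j.
apply: (@le_trans _ _ (P (E i `|` D `\` E i))).
  apply: le_measure; rewrite ?inE //.
    by apply: measurableU => //; exact: measurableD.
  by move=> w Dw; have [|] := pselect (E i w); [left|right].
by apply: measureU2 => //; exact: measurableD.
Qed.

Variable S : seq G.

(** Before time [j] the walk is only known to be in [S]; from [j] to [n] it follows
    [y]. *)
Definition killed_cylinder (j n : nat) (y : nat -> G) (k : nat) : set G :=
  if (k < j)%N then [set` S] else if (k <= n)%N then [set y k] else setT.

(** The Markov property is only given for full trajectories.  The positions at the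
    times [0, .., j - 1] are released one at a time: releasing the one at time [j]
    costs a finite union over [S], and the recursion that defines [killed] sums the
    corresponding bounds. *)
Lemma prob_killed_cylinder_le j n (y : nat -> G) : (j <= n)%N ->
  (P (trajectories_in (killed_cylinder j n y)) <=
   (killed p o S j (y j) * \prod_(j <= i < n) p (y i) (y i.+1))%:E)%E.
Proof.
have [mX Xo Xstep] := hX.
elim: j y => [|j IH] y jn.
  elim: n {jn} => [|n IHn].
    rewrite big_geq //= mulr1.
    have [yo|yo] := eqVneq (y 0%N) o.
      by apply: probability_le1; exact: measurable_trajectories_in.
    have mo : measurable [set w | X 0%N w = o] by exact: (mX 0%N [set o]).
    have : (P (~` [set w | X 0%N w = o]) = 0)%E.
      by rewrite probability_setC // Xo subee.
    move=> Po0; apply: (@le_trans _ _ 0%E) => //; rewrite -Po0.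
    apply: le_measure; rewrite ?inE.
    + exact: measurable_trajectories_in.
    + exact: measurableC.
    + by move=> w /(_ 0%N) /= -> /eqP; rewrite (negbTE yo).
  rewrite big_nat_recr //= mulrA EFinM.
  have cyl l : trajectories_in (killed_cylinder 0 l y) =
      [set w | forall k, (k <= l)%N -> X k w = y k].
    apply/seteqP; split => w /= H k; have := H k; rewrite /killed_cylinder ltn0.
      by case: (leqP k l).
    by case: (leqP k l) => // _; apply.
  rewrite cyl Xstep -cyl; apply: lee_pmul => //; by rewrite lee_fin; case: hp.
pose z b k := if k == j then b else y k.
apply: (@le_trans _ _ (\sum_(b <- S) P (trajectories_in (killed_cylinder j n (z b))))%E).
  apply: measure_le_sum => [|b|w Hw]; try exact: measurable_trajectories_in.
  exists (X j w); first by have := Hw j; rewrite /killed_cylinder ltnSn.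
  move=> k; have := Hw k; rewrite /killed_cylinder /z ltnS.
  by case: ltngtP => [//||->] //; rewrite (ltnW jn).
rewrite /= mulr_suml -sumEFin; apply: lee_sum => b _.
apply: le_trans (IH (z b) (ltnW jn)) _.
rewrite lee_fin big_ltn // /z eqxx gtn_eqF // mulrA ler_wpM2l //.
  by rewrite mulr_ge0 //; [exact: killed_ge0|case: hp].
rewrite le_eqVlt; apply/orP; left; apply/eqP; rewrite big_nat [RHS]big_nat.
by apply: eq_bigr => i /andP[ji _]; rewrite !gtn_eqF // ltnW.
Qed.

Lemma prob_visit_le (A : set G) k :
  (P [set w | A (X k w) /\ forall i, (i <= k)%N -> X i w \in S] <=
   (\sum_(x <- S | `[< A x >]) killed p o S k x)%:E)%E.
Proof.
have mD (x : G) := measurable_trajectories_in (killed_cylinder k k (fun=> x)).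
apply: (@le_trans _ _ (\sum_(x <- [seq x <- S | `[< A x >]])
    P (trajectories_in (killed_cylinder k k (fun=> x))))%E); last first.
  rewrite big_filter -sumEFin; apply: lee_sum => x _.
  apply: le_trans (prob_killed_cylinder_le k k (fun=> x) (leqnn k)) _.
  by rewrite big_geq // mulr1.
apply: measure_le_sum => // [|w [Ak Sk]].
  rewrite (_ : mkset _ = trajectories_in (fun i =>
    if (i < k)%N then [set` S] else if (i == k)%N then A `&` [set` S] else setT)).
    exact: measurable_trajectories_in.
  apply/seteqP; split=> w /=.
    move=> [Ak Sk] i; case: ltngtP => [ik|//|->] /=; first by apply: Sk; exact: ltnW.
    by split=> //; exact: Sk.
  move=> H; have := H k; rewrite ltnn eqxx => -[Ak Sk]; split=> // i.
  by rewrite leq_eqVlt => /predU1P[->//|ik]; have := H i; rewrite ik.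
exists (X k w).
  by rewrite mem_filter Sk // andbT; apply/asboolP.
move=> i; rewrite /killed_cylinder; case: ltngtP => [ik|//|->] //=.
by apply: Sk; exact: ltnW.
Qed.

End Probability.

Section Exhaustion.
Context {R : realType} {G : countType} {d : measure_display}
  {Omega : measurableType d}.
Variables (P : probability Omega R) (X : nat -> Omega -> G).
Variables (p : G -> G -> R) (o : G).
Hypothesis hX : markov_chain_from P X p o.
Hypothesis hp : stochastic p.

Definition visit (A B : set G) k : set Omega :=
  [set w | A (X k w) /\ forall i, (i <= k)%N -> B (X i w)].

Lemma measurable_visit A B k : measurable (visit A B k).
Proof.
rewrite (_ : visit A B k = trajectories_in X (fun i =>
    if (i < k)%N then B else if (i == k)%N then A `&` B else setT)).
  exact: (measurable_trajectories_in _ _ _ _ hX).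
apply/seteqP; split=> w /=.
  move=> [Ak Bk] i; case: ltngtP => [ik|//|->] /=; first by apply: Bk; exact: ltnW.
  by split=> //; exact: Bk.
move=> H; have := H k; rewrite ltnn eqxx => -[Ak Bk]; split=> // i.
by rewrite leq_eqVlt => /predU1P[->//|ik]; have := H i; rewrite ik.
Qed.

(** [pickle_inv] rather than [unpickle], so that membership amounts to a bound on
    [pickle x]. *)
Definition truncation (B : set G) n : seq G :=
  [seq x <- undup (pmap pickle_inv (iota 0 n)) | `[< B x >]].

Lemma mem_truncation B n x : (x \in truncation B n) = (pickle x < n)%N && `[< B x >].
Proof.
rewrite mem_filter mem_undup mem_pmap andbC; congr (_ && _).
apply/mapP/idP => [[i]|xn]; last first.
  by exists (pickle x); rewrite ?pickleK_inv // mem_iota.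
by rewrite mem_iota /= => lin xi; have := @pickle_invK G i; rewrite -xi /= => ->.
Qed.

(** Both the time horizon and the finite set [S] increase to their limits, and
    monotone convergence of the measures applies since up to time [k] a trajectory
    only meets finitely many points. *)
Lemma expected_visits_le (A B : set G) (bound : \bar R) :
  (forall S : seq G, uniq S -> (forall x, x \in S -> B x) -> forall N,
    (\sum_(x <- S | `[< A x >]) \sum_(k < N) killed p o S k x)%:E <= bound)%E ->
  (\sum_(0 <= k <oo) P (visit A B k) <= bound)%E.
Proof.
move=> Hbound.
apply: lime_le; first exact: is_cvg_nneseries.
apply: nearW => N.
pose T n := [set` truncation B n].
have visitE k : visit A B k = \bigcup_n visit A (T n) k.
  apply/seteqP; split => [w [Ak Bk]|w [n _ [Ak Tk]]]; last first.
    split=> // i ik; have := Tk i ik; rewrite /T /= mem_truncation.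
    by move=> /andP[_ /asboolP].
  exists (\max_(i < k.+1) (pickle (X i w)).+1) => //; split=> // i ik.
  rewrite /T /= mem_truncation; apply/andP; split; last by apply/asboolP; exact: Bk.
  by apply: (@leq_bigmax_cond _ xpredT (fun i : 'I_k.+1 => (pickle (X i w)).+1)
    (Ordinal (ik : (i < k.+1)%N))).
have cvgk k : P (visit A (T n) k) @[n --> \oo] --> P (visit A B k).
  rewrite visitE; apply: nondecreasing_cvg_mu.
  - by move=> n; exact: measurable_visit.
  - by apply: bigcupT_measurable => n; exact: measurable_visit.
  - move=> n n' nn'; apply/subsetPset => w [Ak Tk]; split => // i ik.
    have := Tk i ik; rewrite /T /= !mem_truncation => /andP[h ->].
    by rewrite (leq_trans h).
have : (\sum_(0 <= k < N) P (visit A (T n) k) @[n --> \oo] -->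
        \sum_(0 <= k < N) P (visit A B k))%E.
  by apply: cvg_nnesum => // k _; exact: nearW.
move=> /cvge_to_le; apply; apply: nearW => n.
apply: le_trans (Hbound (truncation B n) _ _ N).
- rewrite exchange_big /= -sumEFin big_mkord; apply: lee_sum => k _.
  exact: (prob_visit_le _ _ _ _ hX).
- by rewrite filter_uniq // undup_uniq.
- by move=> x; rewrite mem_truncation => /andP[_ /asboolP].
Qed.

Lemma integral_visits (A B : set G) :
  (\int[P]_w \sum_(0 <= k <oo) (\1_(visit A B k) w)%:E =
   \sum_(0 <= k <oo) P (visit A B k))%E.
Proof.
rewrite integral_nneseries //.
- by apply: eq_eseriesr => k _; rewrite integral_indic ?setIT //; exact: measurable_visit.
- move=> k; apply/measurable_EFinP; apply: measurable_indic; exact: measurable_visit.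
Qed.

Lemma exit_time_le_visits (A : set G) w :
  ((exit_time X A w : \bar R) <= \sum_(0 <= k <oo) (\1_(visit A A k) w)%:E)%E.
Proof.
have ge_n n : (forall i, (i < n)%N -> A (X i w)) ->
    ((n%:R : R)%:E <= \sum_(0 <= k <oo) (\1_(visit A A k) w)%:E)%E.
  move=> An; apply: le_trans (nneseries_lim_ge n _); last by [].
  rewrite sumEFin lee_fin (eq_big_nat _ _ (F2 := fun=> 1)).
    by rewrite big_const_nat subn0 iter_addr_0.
  move=> k kn; rewrite indicE mem_set //; split=> [|i ik]; apply: An => //.
  exact: leq_ltn_trans ik kn.
have [|/forallNP inA] := pselect (exists k, ~ A (X k w)); last first.
  rewrite (_ : \sum_(0 <= k <oo) _ = +oo)%E ?leey //.
  apply/eqyP => c c0; apply: le_trans (ge_n (Num.truncn c).+1 _).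
    by rewrite lee_fin ltW // truncnS_gt.
  by move=> i _; apply: contrapT; exact: inA.
move=> exk; have exb : exists k, `[< ~ A (X k w) >] by have [k ?] := exk; exists k; apply/asboolP.
have := ex_minnP exb => -[k /asboolP nAk kmin].
apply: (@le_trans _ _ (k%:R : R)%:E).
  by apply: ereal_inf_lbound; exists k.
apply: ge_n => i ik; apply: contrapT => nAi.
by have := kmin i; rewrite asboolT // leqNgt ik => /(_ isT).
Qed.

Lemma occupation_time_visits (A : set G) w :
  (occupation_time X A w : \bar R) = (\sum_(0 <= k <oo) (\1_(visit A setT k) w)%:E)%E.
Proof.
rewrite /occupation_time counting_dirac; apply: eq_eseriesr => k _.
rewrite diracE indicE; congr (_%:R%:E); congr nat_of_bool.
by apply/idP/idP; rewrite !inE; [move=> Ak; split|case].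
Qed.

End Exhaustion.

(** * Exit and occupation times *)

Lemma sum_le_vol {R : realType} {G : countType} (m : G -> R) (A : set G) (S : seq G) :
  uniq S -> (forall x, 0 < m x) ->
  ((\sum_(x <- S | `[< A x >]) m x)%:E <= vol m A)%E.
Proof.
move=> uS m0; apply: esum_ge; exists [set` [seq x <- S | `[< A x >]]].
  split; first exact: finite_seq.
  by move=> x /=; rewrite mem_filter => /andP[/asboolP].
by rewrite -fsbig_seq ?filter_uniq // big_filter sumEFin.
Qed.

Theorem theorem1p5 (R : realType) (G : countType)
  (p : G -> G -> R) (m : G -> R) (o : G) (F : R -> R) (C_IS : R)
  (d : measure_display) (Omega : measurableType d)
  (P : G -> probability Omega R) (X : nat -> Omega -> G)
  (hp : stochastic p) (hm : reversible p m)
  (hX : forall x, markov_chain_from (P x) X p x)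
  (hF : isoperimetric_function F)
  (hiso : anchored_isoperimetric p m o F C_IS)
  (A : set G) (hA0 : (0 < vol m A)%E) (hA : (vol m A < +oo)%E) :
  (forall vA : R -> R, solution_from F C_IS (vol m A) vA ->
    (\int[P o]_w exit_time X A w
       <= 2%:E * \int[lebesgue_measure]_(s in `[0%R, +oo[) trunc vA s)%E) /\
  (transient P X ->
   forall v : R -> R, solution_from_pinfty F C_IS v ->
    (\int[P o]_w occupation_time X A w
       <= 2%:E * \int[lebesgue_measure]_(s in `]0%R, +oo[)
                   trunc_at (vol m A) v s)%E).
Proof.
have m0 x : 0 < m x by case: hm.
have exit0 w : (0 <= exit_time X A w :> \bar R)%E.
  by apply: le_ereal_inf_tmp => _ [k _ <-]; rewrite lee_fin.
split.
  move=> v [v0 vmono acv odev].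
  have exitI : (\int[P o]_w exit_time X A w <=
      \sum_(0 <= k <oo) P o (visit X A A k))%E.
    rewrite -(integral_visits _ _ _ _ (hX o)).
    by apply: ge0_le_integral_nonmeasurable => w _ //; exact: exit_time_le_visits.
  apply: le_trans exitI _.
  apply: (expected_visits_le _ _ _ _ (hX o) hp) => S uS SA N.
  apply: le_trans (killed_sum_le_integral p m o S hp hm uS A N (trunc v) _) _.
    move=> t t0; have SvA : \sum_(x <- S) m x <= v 0.
      rewrite -lee_fin v0 -(big_rmcond_in (fun x => `[< A x >])).
        exact: sum_le_vol.
      by move=> x /SA Ax /asboolP.
    have := edge_volume_le_ode p m o S hp hm uS N F C_IS hF hiso v 0 (lexx 0)
      odev acv SvA t (ltW t0).
    set U := edge_volume _ _ _ _; set M := \sum_(x <- S | _) _ => Uv.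
    have mU : Num.min U M <= U by rewrite ge_min lexx.
    rewrite /trunc; case: (ltP 0 (v t)) Uv => vt Uv; rewrite lee_fin; lra.
  rewrite lee_pmul2l //.
  apply: ge0_subset_integral_nonmeasurable => [|s _].
    by move=> s /=; rewrite !in_itv /= !andbT => /ltW.
  by rewrite /trunc; case: ifP => // /ltW; rewrite lee_fin.
move=> _ v [vinf vmono acv odev].
under eq_integral do rewrite occupation_time_visits.
rewrite (integral_visits _ _ _ _ (hX o)).
apply: (expected_visits_le _ _ _ _ (hX o) hp) => S uS _ N.
apply: (killed_sum_le_integral p m o S hp hm uS A N) => t t0.
have [a [a0 at_ Sva]] : exists a, [/\ 0 < a, a <= t & \sum_(x <- S) m x <= v a].
  (* near 0 the solution exceeds the finite mass of [S] *)
  have : \forall s \near 0^'+, [/\ 0 < s, s <= t & \sum_(x <- S) m x <= v s].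
    near=> s; split; first by near: s; exact: nbhs_right_gt.
      by near: s; exact: nbhs_right_le.
    by near: s; move/cvgryPge: vinf; exact.
  by move/filter_ex => [a [? ? ?]]; exists a.
have acva b : a <= b -> abs_continuous_on a b v by move=> ab; exact: acv.
have := edge_volume_le_ode p m o S hp hm uS N F C_IS hF hiso v a (ltW a0)
  odev acva Sva t at_.
set U := edge_volume _ _ _ _; set M := \sum_(x <- S | _) _ => Uv.
have mU : Num.min U M <= U by rewrite ge_min lexx.
have MA : (M%:E <= vol m A)%E by exact: sum_le_vol.
have mM : Num.min U M <= M by rewrite ge_min lexx orbT.
rewrite /trunc_at; case: (leP (v t) 0) => vt.
  by rewrite lee_fin; move: Uv; rewrite max_r; lra.
case: ifP => _; first by apply: le_trans MA; rewrite lee_fin.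
by rewrite lee_fin; move: Uv; rewrite max_l; lra.
Unshelve. all: by end_near. Qed.
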